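(* Let $n\ge2$, $P\in\mathcal{H}_n$, and denote the zeros of $P$ by $x_i(P)$, $1\le i\le n$ (and likewise, for any $R\in\mathcal{H}_n$, its zeros counted with multiplicity by $x_i(R)$, $1\le i\le n$). (i) If $T\in\mathcal{A}'$ then $\min\mathcal{Z}(T(P))\le\min\mathcal{Z}(P)$ and $\max\mathcal{Z}(P)\le\max\mathcal{Z}(T(P))$, so that $\Delta(P)\le\Delta(S(P))$ for any operator $S\in\mathcal{A}$. All these inequalities are strict unless $T=S=\mathrm{Id}$, where $\mathrm{Id}$ is the identity operator on $\mathbb{C}[x]$. (ii) The inequality $F(\mathcal{Z}(P))\le F(\mathcal{Z}(T(P)))$ holds for any Schur convex function $F$ on $\mathbb{R}^n/\Sigma_n$ and any operator $T\in\mathcal{A}'$. In particular, if $f:\mathbb{R}\to\mathbb{R}$ is a convex function then $\sum_{i=1}^nf(x_i(P))\le\sum_{i=1}^nf(x_i(T(P)))$.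
   Context: For $n\ge1$, $\mathcal{H}_n$ is the set of monic polynomials of degree $n$ with only real zeros; $\mathcal{H}_0=\{1\}$. For $n\ge 0$, $\mathcal{A}_n(\mathbb{R})$ is the set of linear maps $T:\mathbb{C}[x]\to\mathbb{C}[x]$ with $T(\mathcal{H}_n)\subseteq\mathcal{H}_n$, and $\mathcal{A}=\bigcap_{n=0}^\infty\mathcal{A}_n(\mathbb{R})$. For non-constant $P\in\mathbb{C}[x]$ let $\sigma(P)$ be the sum of its zeros (with multiplicity), and $\mathcal{A}'=\{T\in\mathcal{A}\mid\sigma(T(P))=\sigma(P)\text{ for all }P\in\mathbb{C}[x],\ \deg P\ge1\}$. $\Sigma_n$ is the symmetric group on $n$ elements, $\mathcal{Z}(P)\in\mathbb{R}^n/\Sigma_n$ is the unordered $n$-tuple of zeros of $P\in\mathcal{H}_n$ counted with multiplicity, and $\Delta(P)=\max\mathcal{Z}(P)-\min\mathcal{Z}(P)$ is the span of $P$. For $X=(x_1,\ldots,x_n),Y=(y_1,\ldots,y_n)\in\mathbb{R}^n$, $X\prec Y$ (majorization) means $\sum_{i=1}^nf(x_i)\le\sum_{i=1}^nf(y_i)$ for every convex $f:\mathbb{R}\to\mathbb{R}$ (equivalently, $X=AY$ for some doubly stochastic $n\times n$ matrix $A$, with $X,Y$ viewed as column vectors). A function $F:\mathbb{R}^n\to\mathbb{R}$ is Schur convex if $F(X)\le F(Y)$ for all $X,Y\in\mathbb{R}^n$ with $X\prec Y$; such $F$ is symmetric and hence is viewed as a function on $\mathbb{R}^n/\Sigma_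n$.
   Formalization: For general S in A, strictness of Δ(P) ≤ Δ(S(P)) is stated unless S is a real translation P(x) ↦ P(x+c), not only unless S = Id: S: P(x) ↦ P(x+1) lies in A, is not Id, and preserves Δ, so the printed clause fails. For T in A' the clause is as printed. *)

(* Defs.v *)
(* The complex numbers are R[i], for R : realType. *)
From HB Require Import structures.
From mathcomp Require Import all_boot all_order all_algebra.
From mathcomp Require Import all_classical all_reals all_analysis.
From mathcomp Require Import complex.

Set Implicit Arguments.
Unset Strict Implicit.
Unset Printing Implicit Defensive.

Import Order.TTheory GRing.Theory Num.Theory.
Local Open Scope classical_set_scope.
Local Open Scope ring_scope.
Local Open Scope complex_scope.

Notation endo R := {linear {poly R[i]} -> {poly R[i]}}.

(* For n = 0 this is {1}: a monic polynomial of size 1 is 1. *)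
Definition hyp (R : realType) (n : nat) : set {poly R[i]} :=
  [set P | [/\ P \is monic, size P = n.+1
             & forall z, root P z -> z \is Num.real]].
Arguments hyp : clear implicits.

Definition hyp_preserver_at (R : realType) (n : nat) : set (endo R) :=
  [set T | T @` hyp R n `<=` hyp R n].
Arguments hyp_preserver_at : clear implicits.

Definition hyp_preserver (R : realType) : set (endo R) :=
  \bigcap_(n in [set: nat]) hyp_preserver_at R n.
Arguments hyp_preserver : clear implicits.

(* All complex zeros of P with multiplicity, in an unspecified order. *)
Definition cplx_zeros (R : realType) (P : {poly R[i]}) : seq R[i] :=
  sval (closed_field_poly_normal P).

Definition zero_sum (R : realType) (P : {poly R[i]}) : R[i] :=
  \sum_(z <- cplx_zeros P) z.

Definition hyp_preserver0 (R : realType) : set (endo R) :=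
  [set T | hyp_preserver R T /\
     forall P : {poly R[i]}, (1 < size P)%N -> zero_sum (T P) = zero_sum P].
Arguments hyp_preserver0 : clear implicits.

(* Meant for real-rooted P only, where taking real parts loses nothing. *)
Definition zeros (R : realType) (P : {poly R[i]}) : seq R :=
  [seq complex.Re z | z <- cplx_zeros P].

(* A representative in R^n of the unordered n-tuple of zeros of P in hyp R n;
   the order is irrelevant below, since only symmetric functions of this
   vector are considered. *)
Definition zero_vec (R : realType) (n : nat) (P : {poly R[i]}) : 'rV[R]_n :=
  \row_(i < n) (zeros P)`_i.

(* The default value, the first zero, is itself one of the zeros when P is not
   constant, so it does not affect the minimum or the maximum. *)
Definition min_zero (R : realType) (P : {poly R[i]}) : R :=
  \big[Num.min/head 0 (zeros P)]_(x <- zeros P) x.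

Definition max_zero (R : realType) (P : {poly R[i]}) : R :=
  \big[Num.max/head 0 (zeros P)]_(x <- zeros P) x.

Definition zero_span (R : realType) (P : {poly R[i]}) : R :=
  max_zero P - min_zero P.

Definition majorized (R : realType) (n : nat) (X Y : 'rV[R]_n) : Prop :=
  forall f : R -> R, @convex_function R R^o [set: R] f ->
    \sum_(i < n) f (X 0 i) <= \sum_(i < n) f (Y 0 i).

Definition schur_convex (R : realType) (n : nat) (F : 'rV[R]_n -> R) : Prop :=
  forall X Y : 'rV[R]_n, majorized X Y -> F X <= F Y.

(* Translations map every hyp R n onto itself and preserve the span, so a
   strict increase of the span under an arbitrary hyperbolicity preserver can
   only hold modulo translations; the only translation preserving the sum of
   zeros is the identity. *)
Definition is_translation (R : realType) (S : endo R) : Prop :=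
  exists c : R, forall P : {poly R[i]}, S P = P \Po ('X + c%:C%:P).

(* Main.v *)
Require Import Defs.
From HB Require Import structures.
From mathcomp Require Import all_boot all_order all_algebra.
From mathcomp Require Import all_classical all_reals all_analysis.
From mathcomp Require Import complex.
From mathcomp Require Import ring lra zify.

Set Implicit Arguments.
Unset Strict Implicit.
Unset Printing Implicit Defensive.

Import Order.TTheory GRing.Theory Num.Theory.
Import numFieldNormedType.Exports.
Local Open Scope classical_set_scope.
Local Open Scope ring_scope.
Local Open Scope complex_scope.

(* A preserver L (acting on real polynomials) commutes with real translations:
   the zeros of the translate by -a of L((X + a)^N) have a sum of squares that
   is affine in a and nonnegative, hence constant, so they are bounded and the
   coefficients, polynomial in a, are constant.  So L = \sum u_k D^k / k!.
   If z_1, .., z_N are the zeros of L(X^N), the operators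
   \prod_i (1 - (z_i / N) D) converge to L coefficientwise on each fixed degree.
   One factor 1 - a D, then the translation by a, send \prod (X - x_i) to
   the characteristic polynomial of diag(x) + a (J - 1), J being the all-ones
   matrix, so by Schur's theorem the diagonal x is majorized by the new zeros;
   Rayleigh quotients show moreover that every x_i is passed on both sides by a
   margin of order a^2.  The margins add up to a multiple of \sum (z_i / N)^2,
   which stays away from 0 as N grows unless L is a translation; since the
   translations cancel when \sum z_i = 0, the limit gives both the majorization
   and the strict inequalities. *)

(** * Polynomials with prescribed roots *)

Definition poly_of_roots (R : nzRingType) (s : seq R) : {poly R} :=
  \prod_(x <- s) ('X - x%:P).

Section RootSums.
Variable R : comNzRingType.
Implicit Types (s : seq R) (x a : R).

Lemma poly_of_roots_nil : poly_of_roots [::] = 1 :> {poly R}.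
Proof. exact: big_nil. Qed.

Lemma poly_of_roots_cons x s :
  poly_of_roots (x :: s) = ('X - x%:P) * poly_of_roots s.
Proof. exact: big_cons. Qed.

Lemma size_poly_of_roots s : size (poly_of_roots s) = (size s).+1.
Proof. by rewrite size_prod_XsubC. Qed.

Lemma monic_poly_of_roots s : poly_of_roots s \is monic.
Proof. exact: monic_prod_XsubC. Qed.

Lemma lead_poly_of_roots s : (poly_of_roots s)`_(size s) = 1.
Proof.
by move/monicP: (monic_poly_of_roots s); rewrite /lead_coef size_poly_of_roots.
Qed.

Lemma poly_of_roots_shift s a :
  poly_of_roots s \Po ('X + a%:P) = poly_of_roots [seq x - a | x <- s].
Proof.
elim: s => [|x s IHs] /=; first by rewrite !poly_of_roots_nil comp_polyC.
rewrite !poly_of_roots_cons comp_polyM IHs comp_polyB comp_polyX comp_polyC.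
by congr (_ * _); rewrite polyCB; ring.
Qed.

Lemma poly_of_roots_coefS n s : size s = n.+1 ->
  (poly_of_roots s)`_n = - \sum_(x <- s) x.
Proof.
by move=> sz; rewrite -(@coefPn_prod_XsubC _ s) sz.
Qed.

(** Newton's identity [2 e_2 = p_1^2 - p_2]: it reads the sum of squares of the zeros off the two
    coefficients below the leading one. *)
Lemma poly_of_roots_coefSS n s : size s = n.+2 ->
  (poly_of_roots s)`_n *+ 2 = (\sum_(x <- s) x) ^+ 2 - \sum_(x <- s) x ^+ 2.
Proof.
elim: n s => [|n IHn] [|x [|y s]] //= [sz].
  case: s sz => // _.
  rewrite !poly_of_roots_cons poly_of_roots_nil mulr1 coef0M !coefB !coefX.
  rewrite !coefC /=.
  rewrite !big_cons !big_nil; ring.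
have szy : size (y :: s) = n.+2 by rewrite /= sz.
rewrite poly_of_roots_cons mulrBl coefB coefXM coefCM /= mulrnBl.
rewrite IHn // (poly_of_roots_coefS szy) 2!(big_cons _ _ x).
ring.
Qed.

End RootSums.

(** Induction on the Horner form [p * 'X + c]. The condition [1 <= a0] ensures that multiplying by
    [a] does not decrease the absolute value; a constant [p] is the linear case, solved
    explicitly. *)
Lemma poly_unbounded (R : realFieldType) (p : {poly R}) : (1 < size p)%N ->
  forall B, exists2 a0, 1 <= a0 & forall a, a0 <= a -> B <= `|p.[a]|.
Proof.
elim/poly_ind: p => [|p c IHp]; first by rewrite size_poly0.
rewrite size_MXaddC; case: ifP => // _ szp0 B.
have [szp|szp] := ltnP 1 (size p).
  have [a0 a01 Ha0] := IHp szp (`|B| + `|c|).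
  exists a0 => // a a0a; rewrite hornerMXaddC.
  have := Ha0 _ a0a; have := lerB_normD (p.[a] * a) c; rewrite normrM.
  have : 1 <= `|a| by rewrite ger0_norm; lra.
  have := ler_norm B; have := normr_ge0 p.[a].
  nra.
have pC := size1_polyC szp.
have k0 : p`_0 != 0.
  by apply: contraTneq szp0 => p00; rewrite pC p00 size_poly0.
set k := p`_0 in pC k0; have k'0 : 0 < `|k| by rewrite normr_gt0.
exists (1 + (`|B| + `|c|) / `|k|).
  by rewrite lerDl divr_ge0 // addr_ge0.
move=> a a0a; rewrite hornerMXaddC pC hornerC.
have : `|B| + `|c| <= `|k| * `|a|.
  rewrite mulrC -ler_pdivrMr //; have := ler_norm a; lra.
rewrite -normrM; have := lerB_normD (k * a) c; have := ler_norm B.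
lra.
Qed.

(** * Preservers commute with translations *)

Section Appell.
Variable R : realFieldType.
Implicit Types (p q E F : {poly R}) (a : R) (u : nat -> R) (s t : seq R).

Lemma derivn_comp_XaddC p a n :
  (p \Po ('X + a%:P))^`(n) = p^`(n) \Po ('X + a%:P).
Proof.
elim: n => [|n IHn]; first by rewrite !derivn0.
by rewrite !derivnS IHn deriv_comp derivD derivX derivC addr0 mulr1.
Qed.

Lemma nderivn_comp_XaddC p a n :
  (p \Po ('X + a%:P))^`N(n) = p^`N(n) \Po ('X + a%:P).
Proof.
have n0 : n`!%:R != 0 :> R by rewrite pnatr_eq0 -lt0n fact_gt0.
apply: (scalerI n0); rewrite -comp_polyZ !scaler_nat -!nderivn_def.
exact: derivn_comp_XaddC.
Qed.

Lemma coef_comp_XaddC p a n : (p \Po ('X + a%:P))`_n = p^`N(n).[a].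
Proof.
have -> : (p \Po ('X + a%:P))`_n = (p \Po ('X + a%:P))^`N(n)`_0.
  by rewrite coef_nderivn addn0 binn mulr1n.
by rewrite nderivn_comp_XaddC -horner_coef0 horner_comp !hornerE.
Qed.

(* The sum of squares of the zeros is affine in [a] and nonnegative, hence
   constant; the zeros are then bounded, and so is the value at 0. *)
Lemma real_rooted_translates_eq0 N F E :
  (size E <= N)%N -> E`_0 = 0 ->
  (forall a, exists2 t, size t = N &
     F + (E \Po ('X - a%:P)) = poly_of_roots t) ->
  E = 0.
Proof.
move=> szE E0 H.
have [szE1|szE1] := leqP (size E) 1; first by rewrite (size1_polyC szE1) E0.
case: N szE H => [|[|n]] szE H; try lia.
have coefE a k : (F + (E \Po ('X - a%:P)))`_k = F`_k + E^`N(k).[- a].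
  by rewrite coefD -polyCN coef_comp_XaddC.
(* Since [size E <= n.+2], the divided derivatives of orders [n.+1] and [n] are constant and affine
   respectively. *)
have c1 a : E^`N(n.+1).[- a] = E`_n.+1.
  rewrite (@size1_polyC _ E^`N(n.+1)) ?hornerC.
    by rewrite coef_nderivn addn0 binn mulr1n.
  by apply: leq_trans (size_poly _ _) _; lia.
have c0 a : E^`N(n).[- a] = E`_n - E`_n.+1 *+ n.+1 * a.
  rewrite (@horner_coef_wide _ 2).
    rewrite big_ord_recl big_ord1 !coef_nderivn addn0 addn1 binn /= binSn.
    rewrite expr0 expr1 mulr1n; ring.
  by apply: leq_trans (size_poly _ _) _; lia.
(* Newton's identity, with [c1] and [c0] inserted, gives [A + B * a] as the sum of squares of the
   zeros. *)
pose A := (F`_n.+1 + E`_n.+1) ^+ 2 - (F`_n + E`_n) *+ 2.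
pose B := E`_n.+1 *+ n.+1 *+ 2.
have sq a t : size t = n.+2 -> F + (E \Po ('X - a%:P)) = poly_of_roots t ->
    \sum_(x <- t) x ^+ 2 = A + B * a.
  move=> szt Ht; have := coefE a n; have := coefE a n.+1.
  rewrite c1 c0 Ht (poly_of_roots_coefS szt) => e1 e2.
  have := poly_of_roots_coefSS szt; rewrite e2.
  rewrite /A /B -e1 => /eqP; rewrite -subr_eq0 => /eqP e.
  apply/eqP; rewrite -subr_eq0; apply/eqP; rewrite -[RHS]e; ring.
have AB a : 0 <= A + B * a.
  have [t szt Ht] := H a; rewrite -(sq a t szt Ht).
  by apply: sumr_ge0 => y _; apply: sqr_ge0.
have B0 : B = 0.
  apply/eqP; apply: contraT => Bn0.
  (* At this point the affine function takes the value [-1]. *)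
  have := AB (- (A + 1) / B); rewrite mulrCA divff // mulr1; lra.
have [a0 a01 /(_ a0 (lexx _))] :=
  poly_unbounded szE1 (`|F.[0]| + (A + 1) ^+ n.+2 + 1).
(* The parameter [- a0] makes the value at 0 equal to [F.[0] + E.[a0]], which is up to sign the
   product of zeros of absolute value at most [A + 1]. *)
have [t szt Ht] := H (- a0).
have /(congr1 (horner^~ 0)) := Ht.
rewrite hornerD horner_comp !hornerE opprK => evalt.
have A0 : 0 <= A by have := AB 0; rewrite mulr0 addr0.
have : `|(poly_of_roots t).[0]| <= (A + 1) ^+ n.+2.
  rewrite horner_prod normr_prod -szt.
  have : \sum_(x <- t) x ^+ 2 <= A by rewrite (sq _ t szt Ht) B0; lra.
  elim: (t) => [|x s IHs]; first by rewrite big_nil.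
  rewrite !big_cons => xs; rewrite [(A + 1) ^+ _]exprS.
  have s0 : 0 <= \sum_(j <- s) j ^+ 2 by apply: sumr_ge0 => y _; apply: sqr_ge0.
  have x0 := sqr_ge0 x.
  apply: ler_pM => //; [exact: prodr_ge0 | | by apply: IHs; lra].
  rewrite !hornerE ?sub0r normrN.
  have : `|x| ^+ 2 <= A by rewrite real_normK ?num_real //; lra.
  have := normr_ge0 x; nra.
rewrite -evalt.
have := ler_normB (F.[0] + E.[a0]) F.[0].
have -> : F.[0] + E.[a0] - F.[0] = E.[a0] by ring.
by move=> *; exfalso; lra.
Qed.

(** The operator [\sum_k u_k D^k / k!], truncated at order [m]; by [appell_widen] the truncation has
    no effect once [size p <= m]. *)
Definition appell u m p : {poly R} := \sum_(k < m) u k *: p^`N(k).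

Lemma appellD u m p q : appell u m (p + q) = appell u m p + appell u m q.
Proof.
rewrite /appell -big_split; apply: eq_bigr => k _.
by rewrite nderivnD scalerDr.
Qed.

Lemma appellZ u m c p : appell u m (c *: p) = c *: appell u m p.
Proof.
rewrite /appell scaler_sumr; apply: eq_bigr => k _.
by rewrite nderivnZ !scalerA mulrC.
Qed.

Lemma appell_sum u m I (r : seq I) (P : pred I) (G : I -> {poly R}) :
  appell u m (\sum_(i <- r | P i) G i) = \sum_(i <- r | P i) appell u m (G i).
Proof.
apply: (big_morph _ (appellD u m)).
by rewrite /appell big1 // => k _; rewrite linear0 scaler0.
Qed.

Lemma appell_widen u m p : (size p <= m)%N ->
  appell u m p = appell u (size p) p.
Proof.
move=> pm; rewrite /appell [RHS](big_ord_widen m (fun k => u k *: p^`N(k))) //.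
rewrite [RHS]big_mkcond; apply: eq_bigr => k _; case: ltnP => // szp.
by rewrite nderivn_poly0 // scaler0.
Qed.

Lemma appell_comp_XaddC u m p a :
  appell u m (p \Po ('X + a%:P)) = appell u m p \Po ('X + a%:P).
Proof.
rewrite /appell linear_sum; apply: eq_bigr => k _ /=.
by rewrite nderivn_comp_XaddC comp_polyZ.
Qed.

Lemma appell_Xn u N : appell u N.+1 'X^N =
  \sum_(k < N.+1) (u k * 'C(N, k)%:R) *: 'X^(N - k).
Proof.
by apply: eq_bigr => k _; rewrite nderivnXn -scalerA scaler_nat.
Qed.

Lemma coef_appell_Xn u N k : (k <= N)%N ->
  (appell u N.+1 'X^N)`_(N - k) = u k * 'C(N, k)%:R.
Proof.
move=> kN; have kN1 : (k < N.+1)%N by [].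
rewrite appell_Xn coef_sum (bigD1 (Ordinal kN1)) //= coefZ coefXn eqxx mulr1.
rewrite big1 ?addr0 // => i ik; rewrite coefZ coefXn.
have [e|_] := eqVneq; last by rewrite mulr0.
case/eqP: ik; apply/val_inj => /=; have := ltn_ord i; lia.
Qed.

Variable L : {linear {poly R} -> {poly R}}.
Hypothesis real_rooted_L :
  forall s, exists2 t, size t = size s & L (poly_of_roots s) = poly_of_roots t.

(** Strong induction on the degree [N] of a monomial. The difference [E] of the two images of ['X^N]
    has degree below [N], both being monic, and no constant term, by the choice of [u N].
    Translating [L ((X + a)^N)] by [-a] gives the Appell image of ['X^N] plus [E (X - a)],
    real-rooted for every [a], so [E = 0]. *)
Lemma real_rooted_preserver_appell p :
  L p = appell (fun k => (L 'X^k)`_0) (size p) p.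
Proof.
set u := fun k => _.
suff LXn N : L 'X^N = appell u N.+1 'X^N.
  rewrite -[in LHS](coefK p) -[in RHS](coefK p) !poly_def linear_sum appell_sum.
  apply: eq_bigr => k _.
  rewrite linearZ LXn appellZ !appell_widen ?size_polyXn //.
  by rewrite -poly_def coefK.
elim/ltn_ind: N => N IH.
have Lsmall q : (size q <= N)%N -> L q = appell u N.+1 q.
  move=> szq; rewrite -[q]coefK poly_def linear_sum appell_sum.
  apply: eq_bigr => k _; rewrite linearZ appellZ.
  have kN : (k < N)%N by apply: leq_trans szq.
  by rewrite IH // !appell_widen ?size_polyXn // ltnS ltnW.
have XnE : 'X^N = poly_of_roots (nseq N 0) :> {poly R}.
  by rewrite /poly_of_roots big_nseq subr0 iter_mulr_1.
have monicL : (L 'X^N)`_N = 1.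
  rewrite XnE; have [t szt ->] := real_rooted_L (nseq N 0).
  by rewrite -(lead_poly_of_roots t) szt size_nseq.
have u0 : u 0%N = 1.
  have [t szt Lt] := real_rooted_L [::]; case: t szt Lt => // _.
  by rewrite /u expr0 !poly_of_roots_nil => ->; rewrite coef1.
have monicA : (appell u N.+1 'X^N)`_N = 1.
  by have := coef_appell_Xn u (leq0n N); rewrite subn0 u0 mul1r bin0.
have szX : size ('X^N : {poly R}) = N.+1 by rewrite size_polyXn.
have szA : (size (appell u N.+1 'X^N) <= N.+1)%N.
  apply: leq_trans (size_sum _ _ _) _; apply/bigmax_leqP => k _.
  apply: leq_trans (size_scale_leq _ _) _.
  by apply: leq_trans (size_poly _ _) _; rewrite szX leq_subr.
have szL : (size (L 'X^N) <= N.+1)%N.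
  rewrite XnE; have [t szt ->] := real_rooted_L (nseq N 0).
  by rewrite size_poly_of_roots szt size_nseq.
apply/eqP; rewrite -subr_eq0; apply/eqP.
set E := _ - _.
apply: (@real_rooted_translates_eq0 N (appell u N.+1 'X^N)).
- apply/leq_sizeP => j; rewrite leq_eqVlt => /orP[/eqP<-|Nj].
    by rewrite coefB monicL monicA subrr.
  by rewrite coefB !nth_default ?subrr //; apply: leq_trans Nj.
- have := coef_appell_Xn u (leqnn N); rewrite subnn binn mulr1 => e.
  rewrite coefB e.
  by rewrite /u subrr.
move=> a.
have [t szt Ht] := real_rooted_L (nseq N (- a)).
exists [seq x + a | x <- t]; first by rewrite size_map szt size_nseq.
have -> : [seq x + a | x <- t] = [seq x - - a | x <- t].
  by apply: eq_map => x; rewrite opprK.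
rewrite -poly_of_roots_shift -Ht.
have -> : poly_of_roots (nseq N (- a)) = 'X^N \Po ('X + a%:P).
  rewrite XnE poly_of_roots_shift map_nseq sub0r //.
(* The leading terms cancel, so the induction hypothesis applies to [Q]. *)
pose Q : {poly R} := ('X^N \Po ('X + a%:P)) - 'X^N.
have szQ : (size Q <= N)%N.
  apply/leq_sizeP => j; rewrite leq_eqVlt => /orP[/eqP<-|Nj].
    rewrite coefB coef_comp_XaddC nderivnXn subnn binn coefXn eqxx.
    by rewrite mulr1n expr0 hornerC subrr.
  rewrite coefB !nth_default ?subrr ?szX //.
  by rewrite size_comp_poly2 ?size_XaddC // szX.
have XQ : 'X^N \Po ('X + a%:P) = 'X^N + Q by rewrite addrCA subrr addr0.
rewrite XQ [L _]linearD (Lsmall Q) //.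
have -> : L 'X^N = E + appell u N.+1 'X^N by rewrite /E subrK.
rewrite -addrA -appellD -XQ appell_comp_XaddC [RHS]comp_polyD polyCN.
by rewrite comp_polyXaddC_K addrC.
Qed.

End Appell.

(** * Factored differential operators *)

Section Factorization.
Variable R : realFieldType.
Implicit Types (p q : {poly R}) (z : seq R) (c : R) (u : nat -> R).

Definition sub_deriv p c : {poly R} := p - c *: p^`().

(** The product of the operators [1 - c x D] expands as a polynomial in [c D], whose coefficients
    are those of [poly_of_roots z] in reverse order. *)
Lemma foldl_sub_deriv z c p :
  foldl sub_deriv p [seq c * x | x <- z] =
  \sum_(k < (size z).+1) ((poly_of_roots z)`_(size z - k) * c ^+ k) *: p^`(k).
Proof.
elim: z p => [|x z IHz] p.
  by rewrite /= big_ord1 poly_of_roots_nil coef1 mulr1 scale1r derivn0.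
rewrite [LHS]/= IHz [size (x :: z)]/=.
set m := size z; set q := poly_of_roots z.
have qm1 : q`_m.+1 = 0 by rewrite nth_default // size_poly_of_roots.
(* At [k = m.+1] the truncated difference [m - k] would select the constant coefficient of [q]
   instead of 0, hence the conditional. *)
have coefx k : (k <= m.+1)%N -> (poly_of_roots (x :: z))`_(m.+1 - k) =
    (if k == m.+1 then 0 else q`_(m - k)) - x * q`_(m.+1 - k).
  move=> km; rewrite poly_of_roots_cons mulrBl coefB coefXM coefCM.
  congr (_ - _); have [->|kN] := eqVneq k m.+1; first by rewrite subnn.
  have -> : (m.+1 - k == 0)%N = false by lia.
  by congr (q`_ _); lia.
transitivity (\sum_(k < m.+1) (q`_(m - k) * c ^+ k) *: p^`(k) -
              \sum_(k < m.+1) (x * q`_(m - k) * c ^+ k.+1) *: p^`(k.+1)).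
  rewrite -sumrB; apply: eq_bigr => k _.
  rewrite /sub_deriv derivnB derivnZ -derivSn scalerBr scalerA.
  congr (_ - _ *: _); rewrite exprS; ring.
transitivity (\sum_(k < m.+2)
    (((if k == m.+1 :> nat then 0 else q`_(m - k)) * c ^+ k) *: p^`(k)
     - ((x * q`_(m.+1 - k)) * c ^+ k) *: p^`(k))); last first.
  apply: eq_bigr => k _; rewrite coefx ?mulrBl ?scalerBl //; exact: leq_ord.
rewrite sumrB; congr (_ - _).
  rewrite [RHS]big_ord_recr /= eqxx mul0r scale0r addr0.
  by apply: eq_bigr => k _; rewrite ltn_eqF // ltnW.
rewrite [RHS]big_ord_recl /= subn0 qm1 mulr0 mul0r scale0r add0r.
by apply: eq_bigr => k _; rewrite /bump /= add1n subSS.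
Qed.

(** The coefficient [u k * 'C(N, k)] times [k!], from [D^k = k! (D^k / k!)], yields the falling
    factorial. For [c = 1 / N] the correction to [u k] tends to 1. *)
Lemma foldl_sub_deriv_appell u N z c p : size z = N ->
  poly_of_roots z = appell u N.+1 'X^N ->
  foldl sub_deriv p [seq c * x | x <- z] =
  appell (fun k => u k * ((N ^_ k)%:R * c ^+ k)) N.+1 p.
Proof.
move=> szz zE; rewrite foldl_sub_deriv szz; apply: eq_bigr => k _.
rewrite zE coef_appell_Xn ?leq_ord // nderivn_def -[p^`N(k) *+ _]scaler_nat.
rewrite scalerA; congr (_ *: _); rewrite -bin_ffact natrM; ring.
Qed.

Lemma sub_deriv_comp_XaddC p c b :
  sub_deriv p c \Po ('X + b%:P) = sub_deriv (p \Po ('X + b%:P)) c.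
Proof.
rewrite /sub_deriv comp_polyB comp_polyZ deriv_comp derivD derivX derivC.
by rewrite addr0 mulr1.
Qed.

Lemma foldl_sub_deriv_comp_XaddC p (s : seq R) b :
  foldl sub_deriv p s \Po ('X + b%:P) = foldl sub_deriv (p \Po ('X + b%:P)) s.
Proof. by elim: s p => //= c s IHs p; rewrite IHs sub_deriv_comp_XaddC. Qed.

End Factorization.

(** * Spectra of symmetric matrices *)

(** The matrix determinant lemma for the rank one matrix [const_mx a], in a division-free form that
    applies to polynomial entries; the product of the [d 0 i] is cancelled at the end. *)
Lemma det_diag_sub_const (A : idomainType) n (d : 'rV[A]_n) (a : A) :
  (forall i, d 0 i != 0) ->
  \det (diag_mx d - const_mx a) =
  \prod_i d 0 i - a * \sum_i \prod_(j | j != i) d 0 j.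
Proof.
move=> d0.
pose p := \prod_i d 0 i.
have p0 : p != 0 by apply/prodf_neq0 => i _.
pose e : 'rV[A]_n := \row_i \prod_(j | j != i) d 0 j.
have de i : d 0 i * e 0 i = p by rewrite /e mxE /p [RHS](bigD1 i).
pose u : 'cV[A]_n := const_mx a.
pose v : 'rV[A]_n := const_mx 1.
have uv : u *m v = const_mx a.
  by apply/matrixP => i j; rewrite !mxE big_ord1 !mxE mulr1.
(* [B] is multiplied once on the left, to expose the determinant sought, and
   once on the right by a matrix built from the cofactors [e] of [d]. *)
pose B := block_mx (1%:M : 'M[A]_1) v u (diag_mx d).
have detB : \det B = \det (diag_mx d - const_mx a).
  have : block_mx (1%:M : 'M[A]_1) 0 (- u) 1%:M *m B =
         block_mx 1%:M v 0 (diag_mx d - const_mx a).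
    rewrite mulmx_block !mul1mx !mul0mx !addr0 mulmx1 addNr.
    by rewrite mulNmx uv addrC.
  move/(congr1 determinant).
  by rewrite det_mulmx det_lblock det_ublock !det1 !mul1r.
have : B *m block_mx (p%:M : 'M[A]_1) 0 (- (diag_mx e *m u)) 1%:M =
       block_mx (p%:M - v *m diag_mx e *m u) v 0 (diag_mx d).
  rewrite mulmx_block !mul1mx !mulmx0 !mulmx1 !add0r mulmxN mulmxA.
  rewrite mul_mx_scalar mulmxN mulmxA.
  have -> : diag_mx d *m diag_mx e = p%:M.
    rewrite mulmx_diag -diag_const_mx; congr diag_mx.
    by apply/rowP => i; rewrite !mxE -(de i) mxE.
  by rewrite mul_scalar_mx subrr.
move/(congr1 determinant).
rewrite det_mulmx det_lblock det_ublock !det1 mulr1 det_diag -detB.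
rewrite !det_mx11 !mxE eqxx mulr1n -/p => /(mulIf p0) ->.
congr (_ - _); rewrite mulr_sumr; apply: eq_bigr => i _.
by rewrite mul_mx_diag !mxE mul1r mulrC.
Qed.

Section SymmetricSpectrum.
Variable R : rcfType.
Local Notation toC := (real_complex R).
Local Open Scope sesquilinear_scope.

Lemma char_poly_similar (F : fieldType) n (A B P : 'M[F]_n) :
  P \in unitmx -> P *m A = B *m P -> char_poly A = char_poly B.
Proof.
move=> Pu PA.
have dP : \det (map_mx polyC P) != 0.
  by rewrite det_map_mx polyC_eq0 -unitfE -unitmxE.
apply: (mulfI dP); rewrite [RHS]mulrC /char_poly -!det_mulmx.
congr (\det _); rewrite mulmxBr mulmxBl -!map_mxM PA.
by rewrite mul_mx_scalar mul_scalar_mx.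
Qed.

(** Over the complex numbers [M] is Hermitian, so [M = U^* D U] with [U] unitary and [D] real. The
    squared moduli of the entries of [U] form the doubly stochastic [W] of Schur's theorem; those of
    the entries of [U v] are the weights of the Rayleigh quotient. *)
Lemma symmetric_spectrum n (M : 'M[R]_n) : M^T = M ->
  exists y : 'rV[R]_n,
    [/\ char_poly M = \prod_j ('X - (y 0 j)%:P),
        exists W : 'M[R]_n,
          [/\ forall i j, 0 <= W i j,
              forall i, \sum_j W i j = 1,
              forall j, \sum_i W i j = 1
            & forall i, M i i = \sum_j W i j * y 0 j],
        \sum_i \sum_j M i j ^+ 2 = \sum_j y 0 j ^+ 2
      & forall v : 'rV[R]_n, exists w : 'rV[R]_n,
          [/\ forall j, 0 <= w 0 j,
              \sum_j w 0 j = \sum_i v 0 i ^+ 2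
            & \sum_i \sum_j v 0 i * v 0 j * M i j = \sum_j w 0 j * y 0 j]].
Proof.
move=> Msym.
pose Mc := map_mx toC M.
have Mh : Mc \is hermsymmx.
  apply: realsym_hermsym.
    apply/is_hermitianmxP/matrixP => i j.
    by rewrite expr0 scale1r !mxE -[in LHS]Msym mxE.
  by apply/mxOverP => i j; rewrite mxE complex_real eqxx.
pose U := spectralmx Mc; pose D := spectral_diag Mc.
have Uu : U \is unitarymx by apply: spectral_unitarymx.
have ME : Mc = U ^t* *m diag_mx D *m U.
  have /hermitian_normalmx /orthomx_spectralP := Mh.
  by rewrite invmx_unitary.
have UU : U *m U ^t* = 1%:M by apply/unitarymxP.
have UU' : U ^t* *m U = 1%:M by apply: mulmx1C.
pose y : 'rV[R]_n := \row_j complex.Re (D 0 j).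
have yD j : toC (y 0 j) = D 0 j.
  rewrite mxE; apply: RRe_real.
  by have /mxOverP := hermitian_spectral_diag_real Mh; apply.
have nE (z : R[i]) : toC (complex.Re z ^+ 2 + complex.Im z ^+ 2) = z^* * z.
  by rewrite add_Re2_Im2 normCK mulrC.
have toC_inj := @fmorph_inj _ _ toC.
exists y; split.
- apply: (@map_poly_inj _ _ toC); rewrite map_char_poly rmorph_prod /=.
  rewrite (@char_poly_similar _ _ _ (diag_mx D) U) ?unitarymx_unit //;
    last first.
    by rewrite -/Mc {1}ME !mulmxA UU mul1mx.
  rewrite char_poly_trig ?diag_mx_is_trig //; apply: eq_bigr => j _.
  by rewrite mxE eqxx mulr1n rmorphB /= map_polyX map_polyC /= yD.
- exists (\matrix_(i, j) (complex.Re (U j i) ^+ 2 + complex.Im (U j i) ^+ 2)).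
  split=> [i j|i|j|i].
  + by rewrite mxE addr_ge0 ?sqr_ge0.
  + apply: toC_inj; rewrite rmorph1 rmorph_sum /=.
    have /matrixP/(_ i i) := UU'; rewrite !mxE eqxx mulr1n => <-.
    by apply: eq_bigr => j _; rewrite !mxE nE.
  + apply: toC_inj; rewrite rmorph1 rmorph_sum /=.
    have /matrixP/(_ j j) := UU; rewrite !mxE eqxx mulr1n => <-.
    by apply: eq_bigr => i _; rewrite !mxE nE mulrC.
  + apply: toC_inj; rewrite rmorph_sum /=.
    have /matrixP/(_ i i) := ME; rewrite !mxE => ->.
    apply: eq_bigr => j _; rewrite rmorphM /= yD mul_mx_diag !mxE nE; ring.
(* Both sides are the trace of [M^2], by symmetry on the left and by diagonalization on the
   right. *)
- apply: toC_inj; rewrite !rmorph_sum /=.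
  transitivity (\tr (Mc *m Mc)).
    apply: eq_bigr => i _; rewrite rmorph_sum mxE; apply: eq_bigr => j _ /=.
    by rewrite rmorphXn /= !mxE -[in M j i]Msym mxE expr2.
  have -> : Mc *m Mc = U ^t* *m (diag_mx D *m diag_mx D *m U).
    by rewrite ME !mulmxA -[_ *m U *m U ^t*]mulmxA UU mulmx1.
  rewrite mxtrace_mulC -[_ *m U *m _]mulmxA UU mulmx1.
  rewrite mulmx_diag mxtrace_diag; apply: eq_bigr => j _.
  by rewrite mxE -!yD rmorphXn expr2.
move=> v; pose q := U *m (map_mx toC v)^T.
exists (\row_j (complex.Re (q j 0) ^+ 2 + complex.Im (q j 0) ^+ 2)).
have qE : q ^t* = map_mx toC v *m U ^t*.
  rewrite trmx_mul trmxK map_mxM /=; congr (_ *m _).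
  apply/matrixP => i j; rewrite !mxE; apply/CrealP.
  by rewrite complex_real eqxx.
split=> [j||].
- by rewrite mxE addr_ge0 ?sqr_ge0.
- apply: toC_inj; rewrite !rmorph_sum /=.
  transitivity ((q ^t* *m q) 0 0).
    by rewrite mxE; apply: eq_bigr => j _; rewrite !mxE nE.
  rewrite qE /q mulmxA -[_ *m U ^t* *m U]mulmxA UU' mulmx1 mxE.
  by apply: eq_bigr => j _; rewrite !mxE rmorphXn expr2.
apply: toC_inj; rewrite !rmorph_sum /=.
transitivity ((q ^t* *m diag_mx D *m q) 0 0).
  rewrite qE /q -!mulmxA [U ^t* *m _]mulmxA [_ *m (U *m _)]mulmxA -ME.
  rewrite mxE; apply: eq_bigr => j _ /=.
  rewrite rmorph_sum !mxE mulr_sumr; apply: eq_bigr => k _ /=.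
  rewrite !mxE !rmorphM /=; ring.
rewrite mxE; apply: eq_bigr => j _.
rewrite rmorphM /= yD mul_mx_diag !mxE nE; ring.
Qed.

End SymmetricSpectrum.

(** * Majorization by a factor *)

Lemma deriv_prod_seq (A : comNzRingType) (I : eqType) (r : seq I)
    (F : I -> {poly A}) : uniq r ->
  (\prod_(i <- r) F i)^`() =
  \sum_(i <- r) (F i)^`() * \prod_(j <- r | j != i) F j.
Proof.
elim: r => [|x r IHr] /=; first by rewrite !big_nil derivC.
case/andP=> xr ur; rewrite !big_cons eqxx derivM IHr //=; congr (_ * _ + _).
  rewrite [RHS]big_seq_cond [LHS]big_seq; apply: eq_bigl => j.
  by case: (boolP (j \in r)) => //= jr; apply/esym/(contraNneq _ xr) => <-.
rewrite mulr_sumr; apply: eq_big_seq => i ir.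
rewrite big_cons ifT; first by rewrite mulrCA.
by apply: contraNneq xr => ->.
Qed.

Definition poly_of_row (A : nzRingType) n (x : 'rV[A]_n) : {poly A} :=
  \prod_i ('X - (x 0 i)%:P).

Definition convex_fun (R : realFieldType) (f : R -> R) := forall t x y : R,
  0 <= t -> t <= 1 -> f (t * x + (1 - t) * y) <= t * f x + (1 - t) * f y.

Section Spread.
Variable R : rcfType.

(** The characteristic matrix is [diag (X + a - x_i) - a J], [J] being the all-ones matrix; the
    determinant formula then produces the product of the diagonal minus [a] times its derivative. *)
Lemma char_poly_sub_deriv n (x : 'rV[R]_n) (a : R) :
  char_poly (\matrix_(i, j) (if i == j then x 0 i else a)) =
  sub_deriv (poly_of_row x) a \Po ('X + a%:P).
Proof.
pose d := \row_i ('X - (x 0 i - a)%:P) : 'rV[{poly R}]_n.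
have -> : char_poly (\matrix_(i, j) (if i == j then x 0 i else a)) =
    \det (diag_mx d - const_mx a%:P).
  congr (\det _); apply/matrixP => i j; rewrite !mxE.
  have [->|ij] := eqVneq i j; last by rewrite !mulr0n !add0r.
  by rewrite !mulr1n polyCB; ring.
rewrite det_diag_sub_const => [|i]; last by rewrite mxE polyXsubC_eq0.
rewrite sub_deriv_comp_XaddC /sub_deriv.
have -> : poly_of_row x \Po ('X + a%:P) = \prod_i d 0 i.
  rewrite /poly_of_row rmorph_prod; apply: eq_bigr => i _ /=.
  by rewrite comp_polyB comp_polyX comp_polyC mxE polyCB; ring.
congr (_ - _); rewrite deriv_prod_seq ?index_enum_uniq // mul_polyC.
congr (_ *: _); apply: eq_bigr => i _.
by rewrite mxE derivXsubC mul1r.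
Qed.

(** Induction on the list: the head is combined with the mean of the tail in the proportion
    [t = w i / (w i + W)]. A tail of zero mass has no mean, but then all its weights vanish. *)
Lemma jensen (f : R -> R) (I : Type) (r : seq I) (w y : I -> R) :
  convex_fun f -> (forall i, 0 <= w i) ->
  let W := \sum_(i <- r) w i in
  0 < W -> W * f ((\sum_(i <- r) w i * y i) / W) <= \sum_(i <- r) w i * f (y i).
Proof.
move=> cf w0; elim: r => [|i r IHr] /=; first by rewrite big_nil ltxx.
rewrite !big_cons; set W := \sum_(j <- r) w j in IHr *.
set Y := \sum_(j <- r) w j * y j in IHr *.
set Z := \sum_(j <- r) w j * f (y j) in IHr *.
have W0 : 0 <= W by apply: sumr_ge0.
have wi := w0 i.
have [We|Wn] := eqVneq W 0.
  have all0 g : \sum_(j <- r) w j * g j = 0 :> R.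
    move: We; rewrite /W; elim: (r) => [|j s IHs]; first by rewrite !big_nil.
    rewrite !big_cons => e.
    have s0 : 0 <= \sum_(j <- s) w j by apply: sumr_ge0.
    have wj := w0 j; rewrite IHs; last by lra.
    have -> : w j = 0 by lra.
    by rewrite mul0r addr0.
  rewrite We /Y /Z !all0 !addr0 => wi0.
  by rewrite mulrAC divff ?mul1r // gt_eqF.
have Wp : 0 < W by rewrite lt_def Wn.
move=> wWp; have wWn : w i + W != 0 by rewrite gt_eqF.
pose t := w i / (w i + W).
have tW : t * (w i + W) = w i by rewrite /t divfK.
have t'W : (1 - t) * (w i + W) = W by rewrite mulrBl tW mul1r addrC addKr.
have t0 : 0 <= t by rewrite /t divr_ge0 // ltW.
have t1 : t <= 1 by rewrite /t ler_pdivrMr // mul1r lerDl.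
clearbody t.
have -> : (w i * y i + Y) / (w i + W) = t * y i + (1 - t) * (Y / W).
  apply: (mulIf wWn); rewrite divfK // mulrDl mulrAC tW.
  by rewrite [(1 - t) * _ * _]mulrAC t'W [W * _]mulrC divfK.
have := cf t (y i) (Y / W) t0 t1; have := IHr Wp.
move=> h1 h2; apply: le_trans (_ : w i * f (y i) + W * f (Y / W) <= _).
  apply: le_trans (ler_wpM2l (ltW wWp) h2) _.
  by rewrite mulrDr !mulrA ![(w i + W) * _]mulrC tW t'W.
by rewrite lerD2l.
Qed.

(** If all [y i] were below [c], the nonnegative terms [w i * (c - y i)] would have a sum at most 0,
    which would force every weight to vanish. *)
Lemma weighted_mean_le_some (I : finType) (w y : I -> R) c :
  (forall i, 0 <= w i) -> 0 < \sum_i w i ->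
  c * \sum_i w i <= \sum_i w i * y i -> exists i, c <= y i.
Proof.
move=> w0 W0 cy; apply/existsP; apply: contraT.
rewrite negb_exists => /forallP yc.
have term0 i : 0 <= w i * (c - y i).
  by apply: mulr_ge0 => //; have := yc i; rewrite -ltNge subr_ge0 => /ltW.
have sum0 : \sum_i w i * (c - y i) = 0.
  apply/eqP; rewrite eq_le sumr_ge0 ?andbT //.
  have -> : \sum_i w i * (c - y i) = c * \sum_i w i - \sum_i w i * y i.
    by rewrite mulr_sumr -sumrB; apply: eq_bigr => i _; ring.
  by rewrite subr_le0.
have wz i : w i = 0.
  have /eqP := psumr_eq0P (fun i _ => term0 i) sum0 (i := i) isT.
  rewrite mulf_eq0 => /orP[/eqP //|]; rewrite subr_eq0 => /eqP cE.
  by have := yc i; rewrite cE lexx.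
by move: W0; rewrite big1 ?ltxx.
Qed.

(* [v] measures how much [y] is spread out with respect to [x]: it is the
   increase of the sum of squares, normalized so as to be [a ^+ 2] for the
   diagonal and the spectrum of [diag(x) + a (J - 1)]. *)
Definition spread n (v : R) (x y : 'rV[R]_n) :=
  [/\ forall f, convex_fun f -> \sum_i f (x 0 i) <= \sum_i f (y 0 i),
      \sum_i y 0 i ^+ 2 = \sum_i x 0 i ^+ 2 + (n * n.-1)%:R * v
    & forall K, 0 < K -> \sum_i y 0 i ^+ 2 <= K ^+ 2 -> forall i,
        (exists j, x 0 i + v / (4 * K) <= y 0 j) /\
        (exists j, y 0 j <= x 0 i - v / (4 * K))].

Lemma spread_refl n (x : 'rV[R]_n) : spread 0 x x.
Proof.
split=> [f _ //||K _ _ i]; first by rewrite mulr0 addr0.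
by rewrite mul0r; split; exists i; rewrite ?addr0 ?subr0.
Qed.

(** As [w >= 0], sums of squares increase, so a bound [K] valid for [z] is valid for [y]; the two
    margins then share the denominator [4 * K] and add up. *)
Lemma spread_trans n v w (x y z : 'rV[R]_n) : 0 <= w ->
  spread v x y -> spread w y z -> spread (v + w) x z.
Proof.
move=> w0 [fxy qxy gxy] [fyz qyz gyz]; split=> [f cf||K K0 zK i].
- exact: le_trans (fxy f cf) (fyz f cf).
- by rewrite qyz qxy mulrDr addrA.
have yK : \sum_i y 0 i ^+ 2 <= K ^+ 2.
  by apply: le_trans zK; rewrite qyz lerDl mulr_ge0.
have [[j xy] [j' xy']] := gxy K K0 yK i; rewrite mulrDl; split.
  by have [[k yz] _] := gyz K K0 zK j; exists k; lra.
by have [_ [k yz]] := gyz K K0 zK j'; exists k; lra.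
Qed.

(* Schur's theorem gives the majorization; the Rayleigh quotients of the vectors
   [e_i + t e_k] and [e_i - t e_k], with [t = a / (2 K)], give the margins. *)
Lemma spread_step n (x : 'rV[R]_n) a : (1 < n)%N ->
  exists2 y : 'rV[R]_n, spread (a ^+ 2) x y
    & poly_of_row y = sub_deriv (poly_of_row x) a \Po ('X + a%:P).
Proof.
move=> n1; pose M := \matrix_(i, j) (if i == j then x 0 i else a) : 'M[R]_n.
have Msym : M^T = M.
  apply/matrixP => i j; rewrite !mxE eq_sym.
  by case: eqVneq => // ->.
have [y [My [W [W0 Wr Wc MW]] Mq MR]] := symmetric_spectrum Msym.
exists y; last by rewrite -char_poly_sub_deriv -/M My.
(* The squared Frobenius norm of [M], with its [n * n.-1] off-diagonal entries equal to [a]. *)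
have q : \sum_i y 0 i ^+ 2 = \sum_i x 0 i ^+ 2 + (n * n.-1)%:R * a ^+ 2.
  rewrite -Mq natrM -mulrA -[n%:R]/(n%:R) mulr_natl.
  transitivity (\sum_(i < n) (x 0 i ^+ 2 + n.-1%:R * a ^+ 2)); last first.
    by rewrite big_split /= sumr_const card_ord.
  apply: eq_bigr => i _; rewrite (bigD1 i) //= mxE eqxx; congr (_ + _).
  rewrite (eq_bigr (fun=> a ^+ 2)); last first.
    by move=> j ji; rewrite mxE eq_sym (negbTE ji).
  rewrite sumr_const mulr_natl; congr (_ *+ _).
  by rewrite cardC1 card_ord.
split=> [f cf|//|K K0 yK i].
  have fx i : f (x 0 i) <= \sum_j W i j * f (y 0 j).
    have := @jensen f _ (index_enum 'I_n) _ (fun j => y 0 j) cf (W0 i).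
    rewrite /= Wr divr1 mul1r => /(_ ltr01); rewrite -MW mxE eqxx.
    exact.
  apply: le_trans (ler_sum _ (fun i _ => fx i)) _.
  rewrite exchange_big; apply: ler_sum => j _ /=.
  by rewrite -mulr_suml Wc mul1r.
have [k ki] : exists k : 'I_n, k != i.
  pose k0 := Ordinal (ltnW n1); pose k1 := Ordinal n1.
  have [<-|] := eqVneq k0 i; last by exists k0.
  by exists k1; apply/eqP => /(congr1 val).
have xK j : x 0 j ^+ 2 <= K ^+ 2.
  apply: le_trans yK; rewrite q (bigD1 j) //= -addrA lerDl addr_ge0 //.
    by apply: sumr_ge0 => l _; apply: sqr_ge0.
  by rewrite mulr_ge0 ?sqr_ge0.
have aK : a ^+ 2 <= K ^+ 2.
  apply: le_trans yK; rewrite q -[X in X <= _]add0r lerD //.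
    by apply: sumr_ge0 => l _; apply: sqr_ge0.
  rewrite ler_peMl ?sqr_ge0 // ler1n; lia.
have boundK b : b ^+ 2 <= K ^+ 2 -> - K <= b <= K by move=> *; apply/andP; nra.
(* The quadratic form of [M] at [e_i + t e_k], a vector of squared norm [1 + t ^+ 2]. *)
have ray t : exists w : 'rV[R]_n, [/\ forall j, 0 <= w 0 j,
    \sum_j w 0 j = 1 + t ^+ 2
  & x 0 i + 2 * t * a + t ^+ 2 * x 0 k = \sum_j w 0 j * y 0 j].
  pose v : 'rV[R]_n := \row_j (if j == i then 1 else if j == k then t else 0).
  have vi : v 0 i = 1 by rewrite mxE eqxx.
  have vk : v 0 k = t by rewrite mxE (negbTE ki) eqxx.
  have vj j : (j != i) && (j != k) -> v 0 j = 0.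
    by case/andP=> /negbTE ji /negbTE jk; rewrite mxE ji jk.
  have vsum (g : 'I_n -> R) : (forall j, v 0 j = 0 -> g j = 0) ->
      \sum_j g j = g i + g k.
    move=> g0; rewrite (bigD1 i) //= (bigD1 k) //= big1 ?addr0 //.
    by move=> j /vj/g0.
  have [w [w0 wv wM]] := MR v; exists w; split=> //.
    by rewrite wv vsum ?vi ?vk ?expr1n // => j ->; rewrite expr0n.
  rewrite -wM vsum; last by move=> j ->; rewrite big1 // => l _; rewrite !mul0r.
  rewrite !vsum; try by move=> j ->; rewrite ?mulr0 ?mul0r.
  rewrite !mxE !eqxx (negbTE ki) eq_sym (negbTE ki); ring.
have /andP[xi1 xi2] := boundK _ (xK i); have /andP[xk1 xk2] := boundK _ (xK k).
(* Now [2 * t * a = 4 * K * t ^+ 2] and the margin is [t ^+ 2 * K]. After division by [t ^+ 2] the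
   claim becomes [x_i - x_k + K * (1 + t ^+ 2) <= 4 * K], which holds as the entries of [x] lie in
   [[-K, K]] and [t ^+ 2 <= 1]. *)
pose t := a / (2 * K).
have tE : a = t * (2 * K) by rewrite /t divfK // mulf_neq0 ?gt_eqF.
have gE : a ^+ 2 / (4 * K) = t ^+ 2 * K.
  by rewrite tE; field; rewrite gt_eqF.
have t2 : t ^+ 2 <= 1.
  move: aK; rewrite tE => aK; rewrite -(@ler_pM2r _ (K ^+ 2)) ?exprn_gt0 //.
  have : 0 <= (t * K) ^+ 2 by apply: sqr_ge0.
  rewrite mul1r -exprMn; move: aK; rewrite mulrCA exprMn; lra.
have T0 := sqr_ge0 t.
have tt0 : 0 < 1 + t ^+ 2 by lra.
have tK1 : 0 <= t ^+ 2 * (K * (1 - t ^+ 2)).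
  apply: mulr_ge0 => //; apply: mulr_ge0; [exact: ltW | lra].
clear Msym My Mq.
clearbody t.
rewrite gE; split.
  have [w [w0 ws wy]] := ray t.
  apply: (weighted_mean_le_some w0); rewrite ?ws // -wy tE.
  have : 0 <= t ^+ 2 * (2 * K - (x 0 i - x 0 k)) by apply: mulr_ge0; lra.
  nra.
(* The lower margin: the opposite sign of [t], and the mean of the negated eigenvalues. *)
have [w [w0 ws wy]] := ray (- t).
have [||j yj] := @weighted_mean_le_some _ (fun j => w 0 j) (fun j => - y 0 j)
                      (- (x 0 i - t ^+ 2 * K)) w0.
- by rewrite ws sqrrN.
- rewrite ws sqrrN (eq_bigr (fun j => - (w 0 j * y 0 j))); last first.
    by move=> j _; rewrite mulrN.
  rewrite sumrN -wy tE sqrrN.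
  have : 0 <= t ^+ 2 * (2 * K - (x 0 k - x 0 i)) by apply: mulr_ge0; lra.
  nra.
by exists j; lra.
Qed.

(** Each step brings a translation by its [a]; as translations commute with the factors, they are
    collected into a single one. *)
Lemma spread_steps n (x : 'rV[R]_n) (s : seq R) : (1 < n)%N ->
  exists2 y : 'rV[R]_n, spread (\sum_(a <- s) a ^+ 2) x y
    & poly_of_row y =
      foldl (@sub_deriv R) (poly_of_row x) s \Po ('X + (\sum_(a <- s) a)%:P).
Proof.
move=> n1; elim: s x => [|a s IHs] x.
  exists x; rewrite big_nil; first exact: spread_refl.
  by rewrite addr0 comp_polyXr.
have [y xy yE] := spread_step x a n1; have [z yz zE] := IHs y.
exists z; rewrite big_cons.
  by apply: spread_trans yz => //; apply: sumr_ge0 => b _; apply: sqr_ge0.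
rewrite zE yE -foldl_sub_deriv_comp_XaddC -comp_polyA comp_polyD comp_polyX.
by rewrite comp_polyC [LHS]/= polyCD addrAC addrA.
Qed.

End Spread.

(** * Passage to the limit *)

Lemma poly_of_rowE (A : comNzRingType) n (x : 'rV[A]_n) :
  poly_of_row x = poly_of_roots [seq x 0 i | i <- enum 'I_n].
Proof. by rewrite /poly_of_roots big_map big_enum. Qed.

Lemma poly_of_roots_row (A : nzRingType) n (s : seq A) : size s = n ->
  poly_of_roots s = poly_of_row (\row_(i < n) s`_i).
Proof.
move=> <-; rewrite /poly_of_roots (big_nth 0) big_mkord.
by apply: eq_bigr => i _; rewrite mxE.
Qed.

Section Limit.
Variable R : realType.

(** Compactness of the cube, in a form that avoids subsequences: every neighbourhood of [y] is
    visited at some index with any eventual property. *)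
Lemma row_cluster_point n (K : R) (Y : nat -> 'rV[R]_n) :
  (forall N i, `|Y N 0 i| <= K) ->
  exists y : 'rV[R]_n, forall (P : set nat) (Q : set 'rV[R]_n),
    (\forall N \near \oo, P N) -> nbhs y Q -> exists2 N, P N & Q (Y N).
Proof.
move=> YK.
have cK := @rV_compact R n (fun=> `[- K, K]%classic)
  (fun=> @segment_compact _ _ _).
have [|y [_ cly]] := cK (Y @ \oo) _.
  by apply: (@filterE nat \oo) => N i /=; rewrite in_itv /= -ler_norml.
exists y => P Q PN yQ.
have [_ [[N PN' <-] QN]] : (Y @` P) `&` Q !=set0.
  apply: cly => //; change (\forall N \near \oo, (Y @` P) (Y N)).
  by near=> N; exists N => //; near: N.
by exists N.
Unshelve. all: by end_near. Qed.

(** A product of [k] factors [1 - j / (N + 2)], each tending to 1. The shift by two matches the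
    degrees in [preserver_Xn_roots]. *)
Lemma cvg_ffact_ratio k :
  (N.+2 ^_ k)%:R * N.+2%:R^-1 ^+ k @[N --> \oo] --> (1 : R).
Proof.
have h0 : N.+2%:R^-1 @[N --> \oo] --> (0 : R).
  have := @cvg_harmonic R; rewrite -cvg_shiftS; apply.
elim: k => [|k IHk].
  under eq_cvg do rewrite ffactn0 expr0 mulr1.
  exact: cvg_cst.
have : ((N.+2 ^_ k)%:R * N.+2%:R^-1 ^+ k) * (1 - k%:R * N.+2%:R^-1)
         @[N --> \oo] --> 1 * (1 - k%:R * 0 : R).
  apply: cvgM => //; apply: cvgB; first exact: cvg_cst.
  by apply: cvgM => //; exact: cvg_cst.
rewrite mulr0 subr0 mulr1; apply: cvg_trans; apply: near_eq_cvg; near=> N.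
have kN : (k <= N.+2)%N.
  by do 2 apply: leqW; near: N; exact: nbhs_infty_ge.
have N0 : N.+2%:R != 0 :> R by rewrite pnatr_eq0.
rewrite ffactnSr natrM natrB // exprSr.
have -> : 1 - k%:R / N.+2%:R = (N.+2%:R - k%:R) * N.+2%:R^-1 :> R.
  by rewrite mulrBl divff.
ring.
Unshelve. all: by end_near. Qed.

(** Convexity on the segments from [y] to [y + 1] and to [y - 1] bounds [f] above by [f y + h * C]
    at distance [h]. This upper semicontinuity lets majorization pass to the limit. *)
Lemma convex_fun_near_le (f : R -> R) (y e : R) : convex_fun f -> 0 < e ->
  \forall z \near y, f z <= f y + e.
Proof.
move=> cf e0.
pose C := `|f (y + 1) - f y| + `|f (y - 1) - f y| + 1.
have C0 : 0 < C by rewrite ltr_wpDl // addr_ge0.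
have fC h : 0 <= h -> h <= 1 ->
    f (y + h) <= f y + h * C /\ f (y - h) <= f y + h * C.
  move=> h0 h1; have := cf h (y + 1) y h0 h1; have := cf h (y - 1) y h0 h1.
  have -> : h * (y + 1) + (1 - h) * y = y + h by ring.
  have -> : h * (y - 1) + (1 - h) * y = y - h by ring.
  have := ler_norm (f (y + 1) - f y); have := ler_norm (f (y - 1) - f y).
  have := normr_ge0 (f (y + 1) - f y); have := normr_ge0 (f (y - 1) - f y).
  rewrite /C; set u := `|_|; set w := `|_| => u0 w0 uu ww f1 f2.
  by split; nra.
near=> z.
have z1 : `|y - z| <= 1 by near: z; apply: cvgr_dist_le.
have ze : `|y - z| <= e / C by near: z; apply: cvgr_dist_le; rewrite ?divr_gt0.
have zC : `|y - z| * C <= e by rewrite -ler_pdivlMr.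
have [f1 f2] := fC _ (normr_ge0 (y - z)) z1.
have [yz|yz] := lerP 0 (y - z).
  move: f2 zC; rewrite ger0_norm // => f2 zC.
  have zE : y - (y - z) = z by ring.
  by rewrite zE in f2; lra.
move: f1 zC; rewrite ltr0_norm // => f1 zC.
have zE : y + - (y - z) = z by ring.
by rewrite zE in f1; lra.
Unshelve. all: by end_near. Qed.

Lemma continuous_horner_poly_of_row n (t : R) :
  continuous (fun y : 'rV[R]_n => (poly_of_row y).[t]).
Proof.
have -> : (fun y : 'rV[R]_n => (poly_of_row y).[t]) =
          (fun y => \prod_i (t - y 0 i)).
  apply/funext => y; rewrite horner_prod; apply: eq_bigr => i _.
  by rewrite !hornerE.
apply: (@continuous_big R 'I_n *%R 1 xpredT (@mul_continuous R)) => i _ y.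
apply: (@cvgB _ R^o _ (nbhs y) _ (fun=> t) (fun z : 'rV[R]_n => z 0 i)).
  exact: cvg_cst.
exact: (@coord_continuous R 1 n 0 i y).
Qed.

Variable L : {linear {poly R} -> {poly R}}.
Hypothesis real_rooted_L :
  forall s, exists2 t, size t = size s & L (poly_of_roots s) = poly_of_roots t.
Hypothesis LX0 : (L 'X)`_0 = 0.

Let u k := (L 'X^k)`_0.

(** [LX0] says [u 1 = 0], whence the zero sum; Newton's identity turns the next coefficient
    [u 2 * 'C(N.+2, 2)] into the sum of squares. *)
Lemma preserver_Xn_roots N : exists z : seq R,
  [/\ size z = N.+2, poly_of_roots z = appell u N.+3 'X^(N.+2),
      \sum_(x <- z) x = 0
    & \sum_(x <- z) x ^+ 2 = - u 2 * (N.+2 * N.+1)%:R].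
Proof.
have [z szz zE] := real_rooted_L (nseq N.+2 0).
rewrite size_nseq in szz.
have {}zE : poly_of_roots z = appell u N.+3 'X^(N.+2).
  rewrite -zE /poly_of_roots big_nseq subr0 iter_mulr_1.
  by rewrite (real_rooted_preserver_appell real_rooted_L) size_polyXn.
have c1 : \sum_(x <- z) x = 0.
  have := poly_of_roots_coefS szz.
  have := @coef_appell_Xn _ u N.+2 1 isT.
  have u1 : u 1 = 0 by rewrite /u expr1.
  rewrite zE subn1 /= u1 mul0r => -> /eqP.
  by rewrite eq_sym oppr_eq0 => /eqP.
exists z; split=> //.
have := poly_of_roots_coefSS szz; rewrite c1 zE.
have := @coef_appell_Xn _ u N.+2 2 isT; rewrite !subSS subn0 => ->.
rewrite expr0n sub0r -mulrnAr -mulrnA.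
have -> : ('C(N.+2, 2) * 2 = N.+2 * N.+1)%N.
  by rewrite mulnC -mul_bin_diag bin1.
by move=> /eqP; rewrite -eqr_oppLR => /eqP <-; rewrite mulNr.
Qed.

Lemma preserver_second_moment_ge0 : 0 <= - u 2.
Proof.
have [z [_ _ _ zz]] := preserver_Xn_roots 0.
have : 0 <= \sum_(x <- z) x ^+ 2 by apply: sumr_ge0 => x _; apply: sqr_ge0.
by rewrite zz pmulr_lge0.
Qed.

(** The approximations of [L p] by products of factors have zeros [Y N] in a fixed cube; a cluster
    point of these rows gives the zeros of [L p] and inherits majorization and margins. *)
Lemma preserver_spread n (x : 'rV[R]_n) : (1 < n)%N ->
  exists y : 'rV[R]_n,
    [/\ L (poly_of_row x) = poly_of_row y,
        forall f, convex_fun f -> \sum_i f (x 0 i) <= \sum_i f (y 0 i)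
      & u 2 != 0 -> forall i,
        (exists j, x 0 i < y 0 j) /\ (exists j, y 0 j < x 0 i)].
Proof.
move=> n1; pose v := - u 2; have v0 : 0 <= v := preserver_second_moment_ge0.
pose p := poly_of_row x.
(* The image of [p] under the product of the [1 - (z_i / N.+2) D], the [z_i] being the zeros of
   [L 'X^N.+2]. *)
pose approx (N : nat) :=
  appell (fun k => u k * ((N.+2 ^_ k)%:R * N.+2%:R^-1 ^+ k)) N.+3 p.
have /choice[Y YP] N : exists y : 'rV[R]_n,
    spread (v * (N.+1%:R / N.+2%:R)) x y /\ poly_of_row y = approx N.
  have [z [szz zE z1 z2]] := preserver_Xn_roots N.
  have [y xy yE] := spread_steps x [seq N.+2%:R^-1 * a | a <- z] n1.
  exists y; split.
    move: xy; rewrite big_map.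
    congr (spread _ x y); under eq_bigr do rewrite exprMn.
    have : N.+2%:R != 0 :> R by rewrite pnatr_eq0.
    rewrite -mulr_sumr z2 -/v natrM.
    by move: (N.+2%:R : R) (N.+1%:R : R) => a b a0; field.
  rewrite yE big_map -mulr_sumr z1 mulr0 addr0 comp_polyXr.
  exact: foldl_sub_deriv_appell.
(* The upper bound keeps [Y N] in a fixed cube; the lower one keeps the margins away from 0. *)
have ratio N : 2^-1 <= (N.+1%:R / N.+2%:R : R) <= 1.
  rewrite ler_pdivlMr ?ler_pdivrMr ?ltr0n // mul1r ler_nat leqnSn andbT.
  rewrite mulrC ler_pdivrMr // -natrM ler_nat; lia.
pose B := \sum_i x 0 i ^+ 2 + (n * n.-1)%:R * v.
have B0 : 0 <= B.
  by rewrite addr_ge0 ?mulr_ge0 // sumr_ge0 // => i _; apply: sqr_ge0.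
pose K := B + 1; have K0 : 0 < K by rewrite ltr_wpDl.
have YK N : \sum_i Y N 0 i ^+ 2 <= K ^+ 2.
  have [[_ -> _] _] := YP N; apply: (@le_trans _ _ B).
    rewrite lerD2l ler_wpM2l // ler_piMr //.
    by have /andP[] := ratio N.
  rewrite /K; have := B0; nra.
have YK1 N i : `|Y N 0 i| <= K.
  rewrite -ler_sqr ?nnegrE ?(ltW K0) // real_normK ?num_real //.
  apply: le_trans (YK N); rewrite (bigD1 i) //= lerDl.
  by apply: sumr_ge0 => j _; apply: sqr_ge0.
have [y cly] := row_cluster_point YK1.
exists y; split.
- have Lp : L p = appell u (size p) p.
    exact: real_rooted_preserver_appell.
  have approx_cvg t : (approx N).[t] @[N --> \oo] --> (L p).[t].
    rewrite Lp /appell horner_sum.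
    have : (\sum_(k < size p) (u k * ((N.+2 ^_ k)%:R * N.+2%:R^-1 ^+ k)) *
        (p^`N(k)).[t]) @[N --> \oo] -->
        \sum_(k < size p) (u k * 1) * (p^`N(k)).[t].
      apply: (@cvg_big R _ +%R 0 xpredT (@add_continuous R)) => k _.
      apply: cvgM; last exact: cvg_cst.
      by apply: cvgM; [exact: cvg_cst | exact: cvg_ffact_ratio].
    under eq_bigr do rewrite mulr1.
    under [X in _ --> X -> _]eq_bigr do rewrite -hornerZ.
    apply: cvg_trans; apply: near_eq_cvg; near=> N.
    rewrite /approx appell_widen.
      by rewrite /appell horner_sum; apply: eq_bigr => k _; rewrite hornerZ.
    by do 3 apply: leqW; near: N; exact: nbhs_infty_ge.
  have eval t : (L p).[t] = (poly_of_row y).[t].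
    apply/eqP; rewrite -subr_eq0 -normr_le0; apply/ler_addgt0Pl => e e0.
    rewrite addr0.
    have e2 : 0 < e / 2 by lra.
    have yP : \forall N \near \oo, `|(L p).[t] - (approx N).[t]| <= e / 2.
      exact: (@cvgr_dist_le _ R^o _ _ _ _ _ (approx_cvg t)).
    have yQ : \forall z \near y,
        `|(poly_of_row y).[t] - (poly_of_row z).[t]| <= e / 2.
      exact: (@cvgr_dist_le _ R^o _ _ _ _ _
                (@continuous_horner_poly_of_row n t y)).
    have [N /= PN QN] := cly _ _ yP yQ.
    have [_ YE] := YP N; rewrite YE in QN.
    have := ler_distD (approx N).[t] (L p).[t] (poly_of_row y).[t].
    rewrite [`|(approx N).[t] - _|]distrC; lra.
  (* A nonzero difference [q] would vanish at the [size q] distinct points [0, 1, ..], more than its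
     degree. *)
  apply/eqP; rewrite -subr_eq0; apply/negP => /negP nz.
  set q := _ - _ in nz.
  have := @max_poly_roots _ q [seq k%:R | k <- iota 0 (size q)] nz.
  rewrite size_map size_iota ltnn => H; suff : false by []; apply: H.
    by apply/allP => t _; rewrite /root hornerD hornerN eval subrr.
  by rewrite map_inj_uniq ?iota_uniq // => i j /eqP; rewrite eqr_nat => /eqP.
- move=> f cf; apply/ler_addgt0Pl => e e0; rewrite addrC.
  have n0 : 0 < n%:R :> R by rewrite ltr0n ltnW.
  have en : 0 < e / n%:R by rewrite divr_gt0.
  have yQ : \forall z \near y, forall i : 'I_n,
      f ((z : 'rV[R]_n) 0 i) <= f (y 0 i) + e / n%:R.
    apply: (@filter_forall _ _ (fun i (z : 'rV[R]_n) =>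
      f (z 0 i) <= f (y 0 i) + e / n%:R) (nbhs y)) => i.
    exact: (@coord_continuous R 1 n 0 i y _
              (convex_fun_near_le (y 0 i) cf en)).
  have [N _ QN] := cly setT _ filterT yQ.
  have [[/(_ f cf) xY _ _] _] := YP N; apply: le_trans xY _.
  apply: le_trans (ler_sum _ (fun i _ => QN i)) _.
  rewrite big_split /= sumr_const card_ord -[(e / _) *+ _]mulr_natr divfK //.
  by rewrite gt_eqF.
move=> u2 i; have vp : 0 < v by rewrite lt_def v0 oppr_eq0 u2.
(* A margin valid for every [Y N]; the limit costs at most [g / 2], so strictness survives. *)
pose g := v / 2 / (4 * K).
have g0 : 0 < g by rewrite !divr_gt0 // mulr_gt0.
have yQ : \forall z \near y, forall i : 'I_n,
    `|y 0 i - (z : 'rV[R]_n) 0 i| <= g / 2.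
  apply: (@filter_forall _ _ (fun i (z : 'rV[R]_n) =>
    `|y 0 i - z 0 i| <= g / 2) (nbhs y)) => j.
  apply: (@cvgr_dist_le _ R^o _ _ _ _ _ (@coord_continuous R 1 n 0 j y)).
  by rewrite divr_gt0.
have [N _ QN] := cly setT _ filterT yQ.
have [[_ _ /(_ K K0 (YK N) i)[[j xj] [k xk]]] _] := YP N.
have gN : g <= v * (N.+1%:R / N.+2%:R) / (4 * K).
  rewrite ler_pM2r ?invr_gt0 ?mulr_gt0 // ler_wpM2l //.
  by have /andP[] := ratio N.
move: (v * _ / _) gN xj xk => w gN xj xk; clearbody g.
split; [exists j | exists k].
  have := QN j; rewrite ler_norml => /andP[]; lra.
have := QN k; rewrite ler_norml => /andP[]; lra.
Unshelve. all: by end_near. Qed.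

End Limit.

(** * Complex and real zeros *)

Section Interface.
Variable R : realType.
Local Notation toC := (real_complex R).
Local Notation "p %:CP" := (map_poly toC p) (at level 2, format "p %:CP").

Lemma map_poly_of_roots (s : seq R) :
  (poly_of_roots s)%:CP = poly_of_roots (map toC s).
Proof.
rewrite /poly_of_roots rmorph_prod big_map; apply: eq_bigr => x _ /=.
by rewrite rmorphB /= map_polyX map_polyC.
Qed.

(** [cplx_zeros] is known only through the factorization it provides, which determines it up to
    order. *)
Lemma cplx_zeros_perm (s : seq R) :
  perm_eq (cplx_zeros (poly_of_roots s)%:CP) (map toC s).
Proof.
rewrite /cplx_zeros; case: closed_field_poly_normal => r /= rE.
apply: prod_XsubC_eq.
rewrite -/(poly_of_roots (map toC s)) -map_poly_of_roots rE.
have /monicP -> : (poly_of_roots s)%:CP \is monic.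
  by rewrite monic_map // monic_poly_of_roots.
by rewrite scale1r.
Qed.

Lemma zeros_perm (s : seq R) : perm_eq (zeros (poly_of_roots s)%:CP) s.
Proof.
rewrite -[X in perm_eq _ X](map_id s).
rewrite -[X in perm_eq _ X](@eq_map _ _ (fun x => complex.Re (toC x)) id) //.
rewrite [X in perm_eq _ X](map_comp (@complex.Re R) toC).
by rewrite perm_map // cplx_zeros_perm.
Qed.

Lemma hyp_poly_of_roots (s : seq R) : hyp R (size s) (poly_of_roots s)%:CP.
Proof.
rewrite map_poly_of_roots; split; first exact: monic_poly_of_roots.
  by rewrite size_poly_of_roots size_map.
move=> z; rewrite root_prod_XsubC => /mapP[x _ ->].
by rewrite complex_real.
Qed.

Lemma hyp_roots n (P : {poly R[i]}) : hyp R n P ->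
  exists2 s : seq R, size s = n & P = (poly_of_roots s)%:CP.
Proof.
case=> Pm szP Pr; have [r rE] := closed_field_poly_normal P.
rewrite (monicP Pm) scale1r in rE.
exists (map (@complex.Re R) r).
  by move: szP; rewrite rE size_prod_XsubC size_map => -[].
rewrite map_poly_of_roots -map_comp map_id_in // => z zr /=.
apply: RRe_real; apply: Pr.
by rewrite rE root_prod_XsubC.
Qed.

Lemma bigmin_head_spec (s : seq R) : s != [::] ->
  let m := \big[Num.min/head 0 s]_(x <- s) x in
  m \in s /\ forall x, x \in s -> m <= x.
Proof.
case: s => // d s _; set t := d :: s; split.
  have : {subset t <= t} by [].
  (* Only the folded list is generalized; the default stays the head of the full list [t]. *)
  elim: {1 4}t => [|x r IHr] sub; first by rewrite big_nil mem_head.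
  rewrite big_cons; case: leP => _; first by apply: sub; rewrite mem_head.
  by apply: IHr => y yr; apply: sub; rewrite in_cons yr orbT.
by move=> x xt; apply: bigmin_inf_seq xt _ _.
Qed.

Lemma bigmax_head_spec (s : seq R) : s != [::] ->
  let m := \big[Num.max/head 0 s]_(x <- s) x in
  m \in s /\ forall x, x \in s -> x <= m.
Proof.
case: s => // d s _; set t := d :: s; split.
  have : {subset t <= t} by [].
  elim: {1 4}t => [|x r IHr] sub; first by rewrite big_nil mem_head.
  rewrite big_cons; case: leP => _; last by apply: sub; rewrite mem_head.
  by apply: IHr => y yr; apply: sub; rewrite in_cons yr orbT.
by move=> x xt; apply: bigmax_sup_seq xt _ _.
Qed.

Lemma zeros_row_perm n (x : 'rV[R]_n) :
  perm_eq (zeros (poly_of_row x)%:CP) [seq x 0 i | i <- enum 'I_n].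
Proof. by rewrite poly_of_rowE zeros_perm. Qed.

Lemma mem_zeros_row n (x : 'rV[R]_n) z :
  reflect (exists i, z = x 0 i) (z \in zeros (poly_of_row x)%:CP).
Proof.
rewrite (perm_mem (zeros_row_perm x)).
apply: (iffP mapP) => [[i _ ->]|[i ->]]; exists i => //.
by rewrite mem_enum.
Qed.

Lemma min_zero_row n (x : 'rV[R]_n) : (0 < n)%N ->
  (exists i, min_zero (poly_of_row x)%:CP = x 0 i) /\
  (forall i, min_zero (poly_of_row x)%:CP <= x 0 i).
Proof.
move=> n0; have z0 : zeros (poly_of_row x)%:CP != [::].
  rewrite -size_eq0 (perm_size (zeros_row_perm x)) size_map size_enum_ord.
  by rewrite -lt0n.
have [/mem_zeros_row[i e] H] := bigmin_head_spec z0; split; first by exists i.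
by move=> j; apply: H; apply/mem_zeros_row; exists j.
Qed.

Lemma max_zero_row n (x : 'rV[R]_n) : (0 < n)%N ->
  (exists i, max_zero (poly_of_row x)%:CP = x 0 i) /\
  (forall i, x 0 i <= max_zero (poly_of_row x)%:CP).
Proof.
move=> n0; have z0 : zeros (poly_of_row x)%:CP != [::].
  rewrite -size_eq0 (perm_size (zeros_row_perm x)) size_map size_enum_ord.
  by rewrite -lt0n.
have [/mem_zeros_row[i e] H] := bigmax_head_spec z0; split; first by exists i.
by move=> j; apply: H; apply/mem_zeros_row; exists j.
Qed.

Lemma sum_zero_vec n (x : 'rV[R]_n) (f : R -> R) :
  \sum_(i < n) f (zero_vec n (poly_of_row x)%:CP 0 i) = \sum_(i < n) f (x 0 i).
Proof.
have sz : size (zeros (poly_of_row x)%:CP) = n.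
  by rewrite (perm_size (zeros_row_perm x)) size_map size_enum_ord.
transitivity (\sum_(z <- zeros (poly_of_row x)%:CP) f z).
  rewrite (big_nth 0) sz big_mkord.
  by apply: eq_bigr => i _; rewrite mxE.
by rewrite (perm_big _ (zeros_row_perm x)) big_map big_enum.
Qed.

Lemma convex_functionW (f : R -> R) :
  @convex_function R R^o [set: R] f -> convex_fun f.
Proof.
move=> cf t x y t0 t1.
have := cf (Itv01 t0 t1) x y; rewrite !inE => /(_ I I).
by [].
Qed.

End Interface.

(** * Preservers on complex polynomials *)

Section RealPart.
Variable R : realType.
Local Notation toC := (real_complex R).
Local Notation "p %:CP" := (map_poly toC p) (at level 2, format "p %:CP").

(** [S] read on real polynomials, followed by a translation of the zeros by [-c]. Taking real parts
    makes it a total linear map and loses nothing on real-rooted polynomials. *)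
Definition real_part_shift (S : endo R) (c : R) (p : {poly R}) : {poly R} :=
  map_poly (@complex.Re R) (S p%:CP) \Po ('X + c%:P).

Lemma map_poly_Re_toC (p : {poly R}) : map_poly (@complex.Re R) p%:CP = p.
Proof. by apply/polyP => i; rewrite !coef_map_id0. Qed.

Fact real_part_shift_is_linear S c : linear (real_part_shift S c).
Proof.
move=> a p q; rewrite /real_part_shift -comp_polyZ -comp_polyD; congr (_ \Po _).
rewrite rmorphD /= linearD map_polyZ linearZ.
apply/polyP => i; rewrite coefD coefZ !coef_map_id0 // coefD coefZ.
by case: (_`_i) => ? ?; case: (_`_i) => ? ? /=; rewrite mul0r subr0.
Qed.
HB.instance Definition _ S c :=
  GRing.isLinear.Build R {poly R} {poly R} _ (real_part_shift S c)
    (real_part_shift_is_linear S c).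

Variable S : endo R.
Hypothesis hS : hyp_preserver R S.

Lemma hyp_preserver_roots s : exists2 t : seq R, size t = size s &
  S (poly_of_roots s)%:CP = (poly_of_roots t)%:CP.
Proof.
have /(_ (S (poly_of_roots s)%:CP)) hSs : hyp_preserver_at R (size s) S := hS I.
apply/hyp_roots/hSs; exists (poly_of_roots s)%:CP => //.
exact: hyp_poly_of_roots.
Qed.

Lemma real_part_shift_roots c s : exists2 t : seq R, size t = size s &
  real_part_shift S c (poly_of_roots s) = poly_of_roots t.
Proof.
have [t szt St] := hyp_preserver_roots s.
exists [seq x - c | x <- t]; first by rewrite size_map.
by rewrite /real_part_shift St map_poly_Re_toC poly_of_roots_shift.
Qed.

Lemma hyp_preserver_real_part c s :
  S (poly_of_roots s)%:CP =
  (real_part_shift S (- c) (poly_of_roots s) \Po ('X + c%:P))%:CP.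
Proof.
have [t szt St] := hyp_preserver_roots s.
rewrite /real_part_shift St map_poly_Re_toC -{1}[c]opprK.
by rewrite polyCN comp_polyXaddC_K.
Qed.

Lemma hyp_preserver_X : exists c : R, S 'X = ('X + c%:P)%:CP.
Proof.
have XE : 'X = (poly_of_roots [:: 0 : R])%:CP.
  by rewrite poly_of_roots_cons poly_of_roots_nil mulr1 subr0 map_polyX.
have [[|x [|//]] // _ St] := hyp_preserver_roots [:: 0].
exists (- x); rewrite XE St poly_of_roots_cons poly_of_roots_nil mulr1.
by rewrite polyCN.
Qed.

Variable c : R.
Hypothesis SX : S 'X = ('X + c%:P)%:CP.
(** The shift by [- c] normalizes [S] so that [L] fixes ['X]. *)
Let L : {linear {poly R} -> {poly R}} := real_part_shift S (- c).

Let LX0 : (L 'X)`_0 = 0.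
Proof.
rewrite /L /= /real_part_shift map_polyX SX map_poly_Re_toC.
rewrite comp_polyD comp_polyX comp_polyC polyCN subrK.
by rewrite coefX.
Qed.

(** The zeros of every [L 'X^N] then have a vanishing sum of squares, so [L] fixes all monomials and
    [S] is the translation removed by the normalization. *)
Lemma hyp_preserver_is_translation : (L 'X^2)`_0 = 0 -> is_translation S.
Proof.
move=> LX2; have LXn N : L 'X^N = 'X^N.
  (* Degrees 0 and 1 are treated apart, as [preserver_Xn_roots] starts at degree 2. *)
  have L1 := real_part_shift_roots (- c); case: N => [|[|N]].
  - have [[|//] _] := L1 [::].
    by rewrite poly_of_roots_nil expr0.
  - have [[|x [|//]] // _] := L1 [:: 0].
    rewrite !poly_of_roots_cons poly_of_roots_nil !mulr1 subr0 expr1 => LX.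
    move: LX0; rewrite [L 'X]LX coefB coefX coefC sub0r => /eqP.
    by rewrite oppr_eq0 => /eqP ->; rewrite subr0.
  have [z [szz zE _ zz]] := preserver_Xn_roots L1 LX0 N.
  rewrite (real_rooted_preserver_appell L1) size_polyXn -zE.
  move: zz; rewrite LX2 oppr0 mul0r => /eqP; rewrite psumr_eq0; last first.
    by move=> x _; apply: sqr_ge0.
  move/allP => z0; have -> : z = nseq (size z) 0.
    apply/all_pred1P/allP => x /z0; rewrite /= sqrf_eq0 //.
  by rewrite szz /poly_of_roots big_nseq subr0 iter_mulr_1.
exists c => P.
have SXn N : S 'X^N = 'X^N \Po ('X + c%:C%:P).
  have XE : 'X^N = poly_of_roots (nseq N 0) :> {poly R}.
    by rewrite /poly_of_roots big_nseq subr0 iter_mulr_1.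
  have := hyp_preserver_real_part c (nseq N 0).
  rewrite -XE -[real_part_shift S (- c) 'X^N]/(L 'X^N) LXn map_polyXn => ->.
  by rewrite map_comp_poly map_polyXn rmorphD /= map_polyX map_polyC.
rewrite -[P in LHS]coefK -[P in RHS]coefK !poly_def !linear_sum.
by apply: eq_bigr => k _; rewrite !linearZ /= SXn.
Qed.

Lemma hyp_preserver_spread n (x : 'rV[R]_n) : (1 < n)%N ->
  exists y : 'rV[R]_n,
    [/\ S (poly_of_row x)%:CP = (poly_of_row y)%:CP,
        forall f, convex_fun f ->
          \sum_i f (x 0 i) <= \sum_i f (y 0 i + c)
      & ~ is_translation S -> forall i,
        (exists j, x 0 i < y 0 j + c) /\ (exists j, y 0 j + c < x 0 i)].
Proof.
move=> n1.
have [y [Lx fxy gxy]] :=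
  preserver_spread (real_part_shift_roots (- c)) LX0 x n1.
exists (\row_i (y 0 i - c)).
have yc i : (\row_i (y 0 i - c)) 0 i + c = y 0 i by rewrite mxE subrK.
split=> [|f cf|nt i].
- rewrite poly_of_rowE (hyp_preserver_real_part c) -poly_of_rowE.
  rewrite -[real_part_shift S (- c) _]/(L _) Lx /poly_of_row; congr (_%:CP).
  rewrite rmorph_prod; apply: eq_bigr => i _ /=.
  by rewrite comp_polyB comp_polyX comp_polyC mxE polyCB; ring.
- under [X in _ <= X]eq_bigr do rewrite yc.
  exact: fxy.
have u2 : (L 'X^2)`_0 != 0.
  by apply/eqP => /hyp_preserver_is_translation.
have [[j ij] [k ik]] := gxy u2 i.
by split; [exists j | exists k]; rewrite yc.
Qed.

End RealPart.

(** * Extreme zeros, span and majorization for preservers *)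

Section Extremes.
Variable R : realType.
Local Notation toC := (real_complex R).
Local Notation "p %:CP" := (map_poly toC p) (at level 2, format "p %:CP").
Variables (n : nat) (P : {poly R[i]}).
Hypotheses (n1 : (1 < n)%N) (hP : hyp R n P).

Lemma hyp_row : exists x : 'rV[R]_n, P = (poly_of_row x)%:CP.
Proof.
have [s szs ->] := hyp_roots hP; exists (\row_i s`_i).
by rewrite -poly_of_roots_row.
Qed.

Lemma zero_sum_X_add (c : R) : zero_sum ('X + c%:P)%:CP = - c%:C.
Proof.
have -> : 'X + c%:P = poly_of_roots [:: - c].
  by rewrite poly_of_roots_cons poly_of_roots_nil mulr1 polyCN opprK.
by rewrite /zero_sum (perm_big _ (cplx_zeros_perm _)) big_seq1 rmorphN.
Qed.

(** The preserved sum of zeros, tested on ['X], forces the constant [c] of [T 'X] to vanish; [0%:P]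
    is kept to fit the lemmas stated for ['X + c%:P]. *)
Lemma hyp_preserver0_X (T : endo R) : hyp_preserver0 R T ->
  T 'X = ('X + 0%:P)%:CP.
Proof.
case=> hT zT; have [c TX] := hyp_preserver_X hT.
have := zT 'X; rewrite size_polyX TX => /(_ isT).
have -> : 'X = ('X + 0%:P)%:CP :> {poly R[i]} by rewrite addr0 map_polyX.
rewrite !zero_sum_X_add rmorph0 oppr0 => /eqP; rewrite oppr_eq0 => /eqP c0.
by have -> : c = 0 by case: c0.
Qed.

(** A translation that fixes ['X] is the identity. *)
Lemma hyp_preserver0_not_translation (T : endo R) :
  hyp_preserver0 R T -> ~ (T =1 id) -> ~ is_translation T.
Proof.
move=> hT nT [d Td]; apply: nT => Q; rewrite Td.
have := hyp_preserver0_X hT; rewrite Td comp_polyX addr0 map_polyX => /eqP.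
rewrite -subr_eq0 addrAC subrr add0r => /eqP ->.
by rewrite addr0 comp_polyXr.
Qed.

Lemma translation_zero_span (S : endo R) : hyp_preserver R S ->
  is_translation S -> zero_span (S P) = zero_span P.
Proof.
move=> hS [d Sd]; have [x ->] := hyp_row; have n0 := ltnW n1.
have -> : S (poly_of_row x)%:CP = (poly_of_row (\row_i (x 0 i - d)))%:CP.
  rewrite Sd /poly_of_row !rmorph_prod /=; apply: eq_bigr => i _.
  rewrite !rmorphB /= map_polyX !map_polyC /= comp_polyX comp_polyC.
  by rewrite mxE rmorphB polyCB opprB addrA.
rewrite /zero_span.
have [[i ei] Hi] := min_zero_row x n0; have [[j ej] Hj] := max_zero_row x n0.
have [[k ek] Hk] := min_zero_row (\row_i (x 0 i - d)) n0.
have [[l el] Hl] := max_zero_row (\row_i (x 0 i - d)) n0.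
(* Each extreme index of one row is tested in the other row, which bounds both extremes from both
   sides. *)
have := Hi k; have := Hj l; have := Hk i; have := Hl j.
rewrite ei ej ek el !mxE; lra.
Qed.

(** The extreme zeros of [P] are themselves passed strictly on both sides; the offset [c] cancels in
    the span. *)
Lemma hyp_preserver_extremes (S : endo R) (c : R) : hyp_preserver R S ->
  S 'X = ('X + c%:P)%:CP -> ~ is_translation S ->
  min_zero (S P) + c < min_zero P /\ max_zero P < max_zero (S P) + c.
Proof.
move=> hS SX nS; have [x ->] := hyp_row; have n0 := ltnW n1.
have [y [-> _ /(_ nS) H]] := hyp_preserver_spread hS SX x n1.
have [[i ->] _] := min_zero_row x n0; have [[j ->] _] := max_zero_row x n0.
have [_ [k ik]] := H i; have [[l jl] _] := H j.
have [_ /(_ k)] := min_zero_row y n0; have [_ /(_ l)] := max_zero_row y n0.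
by split; lra.
Qed.

Lemma hyp_preserver0_majorized (T : endo R) : hyp_preserver0 R T ->
  majorized (zero_vec n P) (zero_vec n (T P)).
Proof.
move=> hT f /convex_functionW cf; have [x ->] := hyp_row.
have [y [-> /(_ f cf) H _]] :=
  hyp_preserver_spread hT.1 (hyp_preserver0_X hT) x n1.
rewrite !sum_zero_vec; apply: le_trans H _.
by under eq_bigr do rewrite addr0.
Qed.

End Extremes.

Theorem corollary5 (R : realType) (n : nat) (P : {poly R[i]})
  (hn : (2 <= n)%N) (hP : hyp R n P) :
  (* (i) *)
  ((forall T : endo R, hyp_preserver0 R T ->
      min_zero (T P) <= min_zero P /\ max_zero P <= max_zero (T P)) /\
   (forall S : endo R, hyp_preserver R S ->
      zero_span P <= zero_span (S P)) /\
   (forall T : endo R, hyp_preserver0 R T -> ~ (T =1 id) ->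
      [/\ min_zero (T P) < min_zero P, max_zero P < max_zero (T P)
        & zero_span P < zero_span (T P)]) /\
   (forall S : endo R, hyp_preserver R S -> ~ is_translation S ->
      zero_span P < zero_span (S P))) /\
  (* (ii) *)
  ((forall (F : 'rV[R]_n -> R) (T : endo R),
      schur_convex F -> hyp_preserver0 R T ->
      F (zero_vec n P) <= F (zero_vec n (T P))) /\
   (forall (f : R -> R) (T : endo R),
      @convex_function R R^o [set: R] f -> hyp_preserver0 R T ->
      \sum_(i < n) f (zero_vec n P 0 i)
        <= \sum_(i < n) f (zero_vec n (T P) 0 i))).
Proof.
(* The strict inequalities come first; the weak ones follow by separating the identity and the
   translations. *)
have strict0 (T : endo R) : hyp_preserver0 R T -> ~ (T =1 id) ->
    min_zero (T P) < min_zero P /\ max_zero P < max_zero (T P).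
  move=> hT nT; have nt := hyp_preserver0_not_translation hT nT.
  have := hyp_preserver_extremes hn hP hT.1 (hyp_preserver0_X hT) nt.
  by rewrite !addr0.
have span_lt (S : endo R) : hyp_preserver R S -> ~ is_translation S ->
    zero_span P < zero_span (S P).
  move=> hS nS; have [c SX] := hyp_preserver_X hS.
  have [] := hyp_preserver_extremes hn hP hS SX nS.
  rewrite /zero_span; lra.
split; last split.
- split; [|split; [|split]] => //.
  + move=> T hT; have [Tid|Tid] := pselect (T =1 id); first by rewrite Tid.
    by have [/ltW ? /ltW ?] := strict0 T hT Tid.
  + move=> S hS; have [St|St] := pselect (is_translation S).
      by rewrite (translation_zero_span hn hP hS St).
    exact/ltW/span_lt.
  + move=> T hT nT; have [? ?] := strict0 T hT nT; split=> //.
    exact: span_lt hT.1 (hyp_preserver0_not_translation hT nT).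
- by move=> F T FS hT; apply: FS; apply: hyp_preserver0_majorized.
by move=> f T cf hT; apply: hyp_preserver0_majorized.
Qed.
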